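(* Let $T:\mathbb{R}^n\to\mathbb{R}^n$ be a cutter and let $\mathcal{F}:\mathbb{R}^n\to\mathbb{R}^n$. Assume that: (1) $\mathcal{F}$ is continuous on $(\operatorname{Fix}(T))_\varepsilon$ for some $\varepsilon>0$; (2) $\mathcal{F}$ is $\alpha$-strongly monotone on $(\operatorname{Fix}(T))_\varepsilon$ for some $\varepsilon>0$ and some $\alpha>0$, i.e. $\langle \mathcal{F}(x)-\mathcal{F}(y),x-y\rangle\ge\alpha\|x-y\|^2$ for all $x,y\in(\operatorname{Fix}(T))_\varepsilon$ (the $\varepsilon$ in (1) and (2) need not a priori be the same); (3) for some $q\in\operatorname{Fix}(T)$ there exist $\beta>0$ and a bounded subset $E\subseteq\mathbb{R}^n$ such that $\langle\mathcal{F}(x),x-q\rangle\ge\beta\|\mathcal{F}(x)\|$ for all $x\notin E$; (4) $I-T$ is closed at $0$. Then any sequence $\{x^k\}_{k=0}^\infty$ generated by the Algorithm described in the context converges to the unique solution $x^*$ of the variational inequality problem VIP$(\mathcal{F},\operatorname{Fix}(T))$.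
   Context: $\mathbb{R}^n$ carries an inner product $\langle\cdot,\cdot\rangle$ with induced norm $\|\cdot\|$; $I$ is the identity operator; $\operatorname{Fix}(T)=\{x\in\mathbb{R}^n\mid T(x)=x\}$. An operator $T:\mathbb{R}^n\to\mathbb{R}^n$ is called a cutter if $\operatorname{Fix}(T)\ne\emptyset$ and $\langle T(x)-x,T(x)-w\rangle\le 0$ for all $(x,w)\in\mathbb{R}^n\times\operatorname{Fix}(T)$. The fixed point set of a cutter is closed and convex. For a nonempty closed convex set $C\subseteq\mathbb{R}^n$ and $r\ge0$, $C_r:=\{u\in\mathbb{R}^n\mid \operatorname{dist}(u,C)\le r\}$, where $\operatorname{dist}(u,C)=\inf_{z\in C}\|u-z\|$. $I-T$ is closed at $0$ means: whenever $x^k\to x$ and $\|T(x^k)-x^k\|\to0$, one has $x\in\operatorname{Fix}(T)$. VIP$(\mathcal{F},\operatorname{Fix}(T))$: find $x^*\in\operatorname{Fix}(T)$ such that $\langle\mathcal{F}(x^* ),x-x^*\rangle\ge0$ for all $x\in\operatorname{Fix}(T)$. (Under (1) and (2) it has a unique solution.) For $x,y\in\mathbb{R}^n$, $H(x,y):=\{u\in\mathbb{R}^n\mid\langle u-y,x-y\rangle\le0\}$. Algorithm. Let $\{\rho_k\}_{k=0}^\infty$ be a sequence of positive numbers with $\lim_{k\to\infty}\rho_k=0$ and $\sum_{k=1}^\infty\rho_k=+\infty$, let $\mu\in(0,1)$, and let $\alpha_k\in[\mu,2-\mu]$ for all $k\ge0$. Choose an arbitrary $x^0\in\mathbb{R}^n$.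 Given $x^k$, let $H_k:=H(x^k,T(x^k))$, let $$z^k:=\begin{cases}x^k-\rho_k\,\mathcal{F}(x^k)/\|\mathcal{F}(x^k)\| & \text{if }\mathcal{F}(x^k)\ne0,\\ x^k & \text{if }\mathcal{F}(x^k)=0,\end{cases}$$ and set $x^{k+1}:=P_{\alpha_k}(z^k)$, where $P_{\alpha_k}:=I+\alpha_k(P_{H_k}-I)$ and $P_{H_k}$ is the metric projection of $\mathbb{R}^n$ onto $H_k$. *)

(* Defs.v *)
From HB Require Import structures.
From mathcomp Require Import all_boot all_order all_algebra.
From mathcomp Require Import sesquilinear.
From mathcomp Require Import all_classical all_reals all_analysis.

Set Implicit Arguments.
Unset Strict Implicit.
Unset Printing Implicit Defensive.

Import Order.TTheory GRing.Theory Num.Theory.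
Import numFieldNormedType.Exports.

Local Open Scope classical_set_scope.
Local Open Scope ring_scope.

(* The space R^n is 'rV[R]_n with an arbitrary inner product
   dot : {dot 'rV[R]_n for idfun} (symmetric, bilinear, positive definite).
   All metric notions below use the norm [dnorm dot] induced by dot. The
   library norm `|x| of 'rV[R]_n is the sup norm; it only enters through the
   topology ( --> and continuity) and through [bounded_set], which do not
   depend on the choice of a norm on R^n. *)
Section EuclideanSpace.
Variables (R : realType) (n : nat) (dot : {dot 'rV[R]_n for idfun}).
Local Notation V := 'rV[R]_n.
Local Notation "''[' u , v ]" := (dot u%R v%R) : ring_scope.

Definition dnorm (u : V) : R := Num.sqrt '[u, u].

Definition dist (u : V) (C : set V) : R := inf [set dnorm (u - z) | z in C].

Definition enlargement (C : set V) (r : R) : set V := [set u | dist u C <= r].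

Definition Fix (T : V -> V) : set V := [set x | T x = x].

Definition cutter (T : V -> V) : Prop :=
  Fix T !=set0 /\
  forall x w : V, w \in Fix T -> '[T x - x, T x - w] <= 0.

Definition residual_closed_at0 (T : V -> V) : Prop :=
  forall (x : nat -> V) (l : V),
    x k @[k --> \oo] --> l ->
    dnorm (T (x k) - x k) @[k --> \oo] --> (0 : R) ->
    l \in Fix T.

Definition strongly_monotone (a : R) (A : set V) (F : V -> V) : Prop :=
  forall x y : V, x \in A -> y \in A ->
    a * dnorm (x - y) ^+ 2 <= '[F x - F y, x - y].

Definition vip_solution (F : V -> V) (C : set V) (xs : V) : Prop :=
  xs \in C /\ forall x : V, x \in C -> 0 <= '[F xs, x - xs].

Definition halfspace (x y : V) : set V := [set u | '[u - y, x - y] <= 0].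

Definition is_nearest (C : set V) (z p : V) : Prop :=
  p \in C /\ forall u : V, u \in C -> dnorm (z - p) <= dnorm (z - u).

(* The default value 0 is irrelevant: the projection is only applied to the
   sets H(x, y), which are half-spaces or all of R^n, where the nearest point
   exists and is unique. *)
Definition metric_proj (C : set V) (z : V) : V := xget 0 (is_nearest C z).

Definition relaxed_proj (a : R) (C : set V) (z : V) : V :=
  z + a *: (metric_proj C z - z).

Definition descent_point (F : V -> V) (r : R) (x : V) : V :=
  if F x == 0 then x else x - (r / dnorm (F x)) *: F x.

Definition generated (T F : V -> V) (rho al : nat -> R) (x : nat -> V) : Prop :=
  forall k : nat,
    x k.+1 = relaxed_proj (al k) (halfspace (x k) (T (x k)))
                          (descent_point F (rho k) (x k)).

End EuclideanSpace.

(* Main.v *)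
(* The relaxed projection onto H_k is quasi-nonexpansive with respect to Fix T,
   so by the coercivity condition (3) the iterates stay bounded. Away from
   Fix T compactness and closedness of I - T at 0 bound the residual below, and
   the resulting decrease of the distance beats the vanishing steps rho_k; hence
   dist(x^k, Fix T) -> 0. Averages of the iterates with weights
   rho_k / ||F(x^k)|| then cluster at a point of Fix T solving the Minty
   inequality, which gives a solution x* of the VIP; no separate existence
   theorem is needed. Finally, strong monotonicity makes ||x^k - x*||^2 decrease
   by at least c rho_k as long as it stays above a given threshold, and the
   divergence of the series of rho_k forces it below that threshold for good. *)

Require Import Defs.
From HB Require Import structures.
From mathcomp Require Import all_boot all_order all_algebra.
From mathcomp Require Import sesquilinear.
From mathcomp Require Import all_classical all_reals all_analysis.
From mathcomp Require Import ring lra.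

Set Implicit Arguments.
Unset Strict Implicit.
Unset Printing Implicit Defensive.

Import Order.TTheory GRing.Theory Num.Theory.
Import numFieldNormedType.Exports.

Local Open Scope classical_set_scope.
Local Open Scope ring_scope.

(** * Inner-product calculus, and comparison of its norm with the sup norm *)

Section InnerProduct.
Variables (R : realType) (n : nat) (dot : {dot 'rV[R]_n for idfun}).
Local Notation V := 'rV[R]_n.
Local Notation N := (dnorm dot).

Lemma dotC (u v : V) : dot u v = dot v u.
Proof. by rewrite hermC expr0 mul1r. Qed.

Lemma dotDl (u v w : V) : dot (u + v) w = dot u w + dot v w.
Proof. exact: linearDl. Qed.

Lemma dotDr (u v w : V) : dot u (v + w) = dot u v + dot u w.
Proof. exact: linearDr. Qed.

Lemma dotNl (u v : V) : dot (- u) v = - dot u v.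
Proof. exact: linearNl. Qed.

Lemma dotNr (u v : V) : dot u (- v) = - dot u v.
Proof. exact: linearNr. Qed.

Lemma dot0l (u : V) : dot 0 u = 0.
Proof. exact: linear0l. Qed.

Lemma dot0r (u : V) : dot u 0 = 0.
Proof. exact: linear0r. Qed.

Lemma dotZl (a : R) (u v : V) : dot (a *: u) v = a * dot u v.
Proof. exact: linearZl_LR. Qed.

Lemma dotZr (a : R) (u v : V) : dot u (a *: v) = a * dot u v.
Proof. exact: linearZr_LR. Qed.

Definition dotE := (dotDl, dotDr, dotNl, dotNr, dotZl, dotZr, dot0l, dot0r).

Lemma dot_ge0 (u : V) : 0 <= dot u u.
Proof.
have [->|u0] := eqVneq u 0; first by rewrite !dotE.
exact/ltW/neq0_dnorm_gt0.
Qed.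

Lemma dot_eq0 (u : V) : dot u u = 0 -> u = 0.
Proof.
have [->//|u0] := eqVneq u 0 => d0.
have : 0 < dot u u := neq0_dnorm_gt0 u u0.
by rewrite d0 ltxx.
Qed.

Lemma dnorm_ge0 (u : V) : 0 <= N u.
Proof. exact: sqrtr_ge0. Qed.

Lemma dnorm_sqr (u : V) : N u ^+ 2 = dot u u.
Proof. by rewrite sqr_sqrtr ?dot_ge0. Qed.

Lemma dnorm0 : N 0 = 0.
Proof. by rewrite /dnorm !dotE sqrtr0. Qed.

Lemma dnorm_eq0 (u : V) : N u = 0 -> u = 0.
Proof. by move=> u0; apply: dot_eq0; rewrite -dnorm_sqr u0 expr0n. Qed.

Lemma dnormN (u : V) : N (- u) = N u.
Proof. by rewrite /dnorm !dotE opprK. Qed.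

Lemma dnormBC (u v : V) : N (u - v) = N (v - u).
Proof. by rewrite -dnormN opprB. Qed.

Lemma dnormZ (a : R) (u : V) : N (a *: u) = `|a| * N u.
Proof.
by rewrite /dnorm dotZl dotZr mulrA -expr2 sqrtrM ?sqr_ge0// sqrtr_sqr.
Qed.

Lemma dnormD_sqr (u v : V) : N (u + v) ^+ 2 = N u ^+ 2 + 2 * dot u v + N v ^+ 2.
Proof. by rewrite !dnorm_sqr !dotE (dotC v u); ring. Qed.

Lemma dnormB_sqr (u v : V) : N (u - v) ^+ 2 = N u ^+ 2 - 2 * dot u v + N v ^+ 2.
Proof. by rewrite dnormD_sqr dnormN !dotE; ring. Qed.

Lemma cauchy_schwarz (u v : V) : dot u v <= N u * N v.
Proof.
have [->|v0] := eqVneq v 0; first by rewrite dnorm0 dotE mulr0.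
have [->|u0] := eqVneq u 0; first by rewrite dnorm0 !dotE mul0r.
have pos w : w != 0 -> 0 < N w.
  move=> w0; rewrite lt_def dnorm_ge0 andbT.
  by apply: contraNneq w0 => /dnorm_eq0 ->.
have u1 := pos _ u0; have v1 := pos _ v0.
(* Expanding this square gives [2 * N u * N v * (N u * N v - dot u v) >= 0], with both norms
   positive. *)
have := sqr_ge0 (N (N v *: u - N u *: v)).
rewrite dnormB_sqr !dnormZ !ger0_norm ?dnorm_ge0// dotZl dotZr.
have uv : 0 < N u * N v by rewrite mulr_gt0.
move=> h; rewrite -(ler_pM2l uv); nra.
Qed.

Lemma dnormD (u v : V) : N (u + v) <= N u + N v.
Proof.
rewrite -(ler_pXn2r (ltn0Sn 1)) ?nnegrE ?addr_ge0 ?dnorm_ge0//.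
by rewrite dnormD_sqr; have := cauchy_schwarz u v; nra.
Qed.

Lemma dnorm_triangle (v u w : V) : N (u - w) <= N (u - v) + N (v - w).
Proof. by rewrite -{1}(subrK v u) -addrA dnormD. Qed.

Lemma dnorm_le_norm : exists2 K : R, 0 < K & forall u : V, N u <= K * `|u|.
Proof.
(* The summand 1 keeps the constant positive even when [n = 0]. *)
exists (1 + \sum_(j < n) N (delta_mx 0 j)).
  by rewrite ltr_wpDr ?sumr_ge0// => j _; exact: dnorm_ge0.
move=> u; rewrite mulrDl mul1r ler_wpDl//.
rewrite {1}(row_sum_delta u) mulr_suml.
elim/big_ind2 : _ => [|a b c d ab cd|j _].
- by rewrite dnorm0.
- exact: le_trans (dnormD _ _) (lerD ab cd).
- rewrite dnormZ mulrC ler_wpM2l ?dnorm_ge0//.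
  rewrite [leRHS]/Num.norm /= mx_normrE.
  by apply: (le_bigmax _ (fun ij => `|u ij.1 ij.2|) (ord0, j)).
Qed.

(** Bolzano-Weierstrass: closed sup-norm balls are compact. The cluster point is given by
    arbitrarily late close terms, which avoids extracting subsequences. *)
Lemma norm_cluster (y : nat -> V) (M : R) : (forall k, `|y k| <= M) ->
  exists l : V, forall e : R, 0 < e -> forall m : nat,
    exists2 k, (m <= k)%N & `|y k - l| < e.
Proof.
move=> yM.
have cK : compact [set u : V | `|u| <= M].
  apply: bounded_closed_compact.
    exists M; split; first exact: num_real.
    by move=> x Mx u /= /le_trans; apply; exact: ltW.
  rewrite (_ : mkset _ = (fun u : V => `|u|) @^-1` [set t | t <= M])//.
  by apply: preimage_closed => [u _|]; [exact: norm_continuous|exact: closed_le].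
have [|l [_ cl]] := cK (y @ \oo) _.
  by exists 0%N => // k _; exact: yM.
exists l => e e0 m.
have ymk : (y @ \oo) (y @` [set k | (m <= k)%N]).
  by exists m => // k /= mk; exists k.
have [_ [[k /= mk <-] bk]] := cl _ _ ymk (nbhsx_ballx l e e0).
by exists k => //; move: bk; rewrite -ball_normE /= distrC.
Qed.

(** Otherwise there are vectors of sup norm 1 whose [N] tends to 0; a cluster point would have sup
    norm 1 and [N] equal to 0. *)
Lemma norm_le_dnorm : exists2 K : R, 0 < K & forall u : V, `|u| <= K * N u.
Proof.
apply: contrapT => /forall2NP noK.
have /choice[y yP] (m : nat) : exists u : V, `|u| = 1 /\ m.+1%:R * N u < 1.
  have [//|/existsNP[u /negP]] := noK m.+1%:R.
  rewrite -ltNge => h.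
  have u0 : 0 < `|u| by rewrite (le_lt_trans _ h)// mulr_ge0// dnorm_ge0.
  exists (`|u|^-1 *: u); rewrite normrZ dnormZ !normfV !normr_id.
  by rewrite mulVf ?gt_eqF// mulrCA ltr_pdivrMl// mulr1.
have [k|l cl] := @norm_cluster y 1; first by have [->] := yP k.
have [K K0 NK] := dnorm_le_norm.
have l1 : `|l| = 1.
  apply/eqP/negPn/negP => l1.
  have [|k _] := cl `| `|l| - 1| _ 0%N; first by rewrite normr_gt0 subr_eq0.
  have [<- _] := yP k.
  by rewrite (distrC (y k)) => /(le_lt_trans (ler_dist_dist _ _)); rewrite ltxx.
have l0 : N l = 0.
  apply/eqP/negPn/negP => l0.
  have Nl : 0 < N l by rewrite lt_def l0 dnorm_ge0.
  (* Beyond this [m], [N (y k) >= N l / 2] yields [k.+1%:R * N (y k) > 1], against the choice of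
     [y]. *)
  have [m mN] : exists m : nat, 2 / N l < m%:R.
    by exists (Num.bound (2 / N l)); exact: archi_boundP (divr_ge0 _ (ltW Nl)).
  have [k mk yl] := cl (N l / 2 / K) ltac:(by rewrite !divr_gt0) m.
  have [_ yk] := yP k.
  have := dnormD (l - y k) (y k); rewrite subrK.
  have := NK (l - y k); rewrite distrC.
  move: yl; rewrite ltr_pdivlMr// => yl.
  have mk' : m%:R <= k.+1%:R :> R by rewrite ler_nat leqW.
  move: mN; rewrite ltr_pdivrMr// => mN.
  move=> h1 h2.
  have h3 : N l / 2 <= N (y k) by lra.
  have := ler_wpM2r (ltW Nl) mk'.
  have := ler_wpM2l (ler0n R k.+1) h3.
  lra.
by move: l1; rewrite (dnorm_eq0 l0) normr0 => /eqP; rewrite eq_sym oner_eq0.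
Qed.

Lemma dnorm_cluster (y : nat -> V) (M : R) : (forall k, N (y k) <= M) ->
  exists l : V, forall e : R, 0 < e -> forall m : nat,
    exists2 k, (m <= k)%N & N (y k - l) < e.
Proof.
move=> yM; have [K K0 NK] := dnorm_le_norm; have [K' K'0 NK'] := norm_le_dnorm.
have [k|l cl] := @norm_cluster y (K' * M).
  by rewrite (le_trans (NK' _))// ler_wpM2l// ltW.
exists l => e e0 m.
have [k mk kl] := cl (e / K) (divr_gt0 e0 K0) m; exists k => //.
by rewrite (le_lt_trans (NK _))// mulrC -ltr_pdivlMr.
Qed.

Lemma cvg_dnorm (y : nat -> V) (l : V) :
  (forall e, 0 < e -> exists m, forall k, (m <= k)%N -> N (y k - l) < e) ->
  y k @[k --> \oo] --> l.
Proof.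
move=> h; apply/cvgrPdist_lt => e e0; have [K K0 NK] := norm_le_dnorm.
have [m hm] := h (e / K) (divr_gt0 e0 K0).
exists m => // k /= mk; rewrite distrC (le_lt_trans (NK _))//.
by rewrite mulrC -ltr_pdivlMr// hm.
Qed.

Lemma within_continuous_dnorm (A : set V) (F : V -> V) (l : V) (e : R) :
  {within A, continuous F} -> A l -> 0 < e ->
  exists2 d, 0 < d & forall z, A z -> N (z - l) < d -> N (F z - F l) < e.
Proof.
move=> /subspace_continuousP cF Al e0.
have [K K0 NK] := dnorm_le_norm; have [K' K'0 NK'] := norm_le_dnorm.
have /cvgrPdist_lt/(_ _ (divr_gt0 e0 K0)) := cF l Al.
move=> /nbhs_ballP[d /= d0 hd].
exists (d / K') => [|z Az zl]; first exact: divr_gt0.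
rewrite (le_lt_trans (NK _))// mulrC -ltr_pdivlMr// distrC hd//.
rewrite -ball_normE /= distrC (le_lt_trans (NK' _))//.
by rewrite mulrC -ltr_pdivlMr.
Qed.

Lemma bounded_set_dnorm (E : set V) : bounded_set E ->
  exists2 M, 0 <= M & forall u, E u -> N u <= M.
Proof.
move=> /pinfty_ex_gt0[M M0 EM]; have [K K0 NK] := dnorm_le_norm.
exists (K * M) => [|u Eu]; first by rewrite mulr_ge0 ?ltW.
by rewrite (le_trans (NK _))// ler_wpM2l ?(ltW K0)//; exact: (EM u Eu).
Qed.

End InnerProduct.

(** * Projection onto a half-space, its relaxation, and the descent step *)

Lemma subr_shift (U : zmodType) (w u v : U) : u - v = (u - w) - (v - w).
Proof. by rewrite opprB addrA subrK. Qed.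

Lemma subr_shiftl (U : zmodType) (w u v : U) : u - v = (w - v) - (w - u).
Proof. by rewrite opprB [RHS]addrC addrA subrK. Qed.

Section RelaxedProjection.
Variables (R : realType) (n : nat) (dot : {dot 'rV[R]_n for idfun}).
Local Notation V := 'rV[R]_n.
Local Notation N := (dnorm dot).

Lemma dnorm_le_sqr (u v : V) : (N u <= N v) = (N u ^+ 2 <= N v ^+ 2).
Proof. by rewrite ler_pXn2r ?nnegrE ?dnorm_ge0. Qed.

(** [metric_proj] is defined by choice, so an explicit [q] satisfying the obtuse-angle inequality is
    exhibited first. That inequality makes [q] the only nearest point, so the chosen point is
    [q]. *)
Lemma halfspace_proj (x y z : V) (p := metric_proj dot (halfspace dot x y) z) :
  halfspace dot x y p /\
  forall w, halfspace dot x y w -> dot (z - p) (w - p) <= 0.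
Proof.
set H := halfspace dot x y; set d := x - y.
suff [q Hq Vq] : exists2 q, H q & forall w, H w -> dot (z - q) (w - q) <= 0.
  have near w : H w -> N (z - q) ^+ 2 + N (w - q) ^+ 2 <= N (z - w) ^+ 2.
    move=> /Vq; rewrite [z - w](_ : _ = (z - q) - (w - q)); last first.
      by rewrite opprB addrA subrK.
    by rewrite (dnormB_sqr _ (z - q)); lra.
  have [|] := @xgetPex _ 0 (is_nearest dot H z).
    exists q; split; first exact: mem_set.
    move=> u /set_mem /near h; rewrite dnorm_le_sqr.
    by have := sqr_ge0 (N (u - q)); lra.
  rewrite -/(metric_proj _ _ _) -/p => /set_mem Hp /(_ _ (mem_set Hq)).
  rewrite dnorm_le_sqr => le_pq.
  suff -> : p = q by [].
  apply/eqP; rewrite -subr_eq0; apply/eqP/(@dnorm_eq0 _ _ dot)/eqP.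
  rewrite -sqrf_eq0 eq_le sqr_ge0 andbT.
  by have := near _ Hp; lra.
(* A point already in the half-space projects to itself; otherwise [d] is nonzero and [z] is moved
   along [d] to the bounding hyperplane. *)
have [zH|zH] := leP (dot (z - y) d) 0.
  by exists z => // w _; rewrite subrr dot0l.
have d0 : 0 < dot d d.
  rewrite lt_def dot_ge0 andbT; apply: contraTneq zH => /dot_eq0 ->.
  by rewrite dot0r ltxx.
pose t := dot (z - y) d / dot d d.
have qd : dot (z - t *: d - y) d = 0.
  rewrite addrAC dotDl dotNl dotZl /t divfK ?gt_eqF// subrr//.
exists (z - t *: d) => [|w]; first by rewrite /H /halfspace /= -/d qd.
rewrite /H /halfspace /= -/d => Hw.
rewrite (_ : z - (z - t *: d) = t *: d) ?dotZl; last by rewrite opprB addrC subrK.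
apply: mulr_ge0_le0.
  by rewrite divr_ge0// ltW.
rewrite [w - _](_ : _ = (w - y) - (z - t *: d - y)).
  by rewrite dotDr dotNr dotC (dotC _ d) qd subr0.
by rewrite [LHS](subr_shift y).
Qed.

Lemma relaxed_proj_le (mu a : R) (x y z w : V) : 0 < mu -> mu <= a <= 2 - mu ->
  halfspace dot x y w ->
  N (relaxed_proj dot a (halfspace dot x y) z - w) ^+ 2 <= N (z - w) ^+ 2
    - mu ^+ 2 * N (metric_proj dot (halfspace dot x y) z - z) ^+ 2.
Proof.
move=> mu0 /andP[mua a2] Hw; rewrite /relaxed_proj.
have /= [_ /(_ _ Hw)] := halfspace_proj x y z; set p := metric_proj _ _ _.
rewrite [w - p](_ : _ = (z - p) - (z - w)); last exact: subr_shiftl.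
rewrite dotDr dotNr -dnorm_sqr dnormBC => Vp.
rewrite addrAC (dnormD_sqr dot (z - w)) dnormZ exprMn real_normK ?num_real// dotZr.
have -> : dot (z - w) (p - z) = - dot (z - p) (z - w).
  by rewrite dotC -dotNl opprB.
set P := N (p - z) in Vp *; set Q := dot _ _ in Vp *.
have P0 : 0 <= P ^+ 2 := sqr_ge0 P.
(* The expanded square contains [a ^+ 2 * P ^+ 2 - 2 * a * Q] with [Q >= P ^+ 2], hence a loss of at
   least [a * (2 - a) * P ^+ 2], and both [a] and [2 - a] are at least [mu]. *)
have : 0 <= (a * (2 - a) - mu ^+ 2) * P ^+ 2 by rewrite mulr_ge0//; nra.
have : a * P ^+ 2 <= a * Q by rewrite ler_wpM2l//; lra.
lra.
Qed.

(** Since [x - y] is normal to the bounding hyperplane through [y], the point [y] is the projection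
    of [x]. With [y = T x] this turns the residual into a lower bound on the way to the
    half-space. *)
Lemma dist_halfspace (x y u : V) : halfspace dot x y u -> N (y - x) <= N (u - x).
Proof.
rewrite /halfspace /= => Hu.
have [->|xy] := eqVneq (N (y - x)) 0; first exact: dnorm_ge0.
have xy0 : 0 < N (y - x) by rewrite lt_def xy dnorm_ge0.
rewrite -(ler_pM2r xy0) -expr2; apply: le_trans (cauchy_schwarz _ _ _).
move: Hu; rewrite [u - y](_ : _ = (u - x) - (y - x)); last exact: subr_shift.
rewrite dnorm_sqr -[x - y]opprB dotNr; set a := u - x; set b := y - x.
by rewrite dotDl dotNl; lra.
Qed.

(** The coefficient of [F x] in the descent step. When [F x = 0] the value [r] keeps it positive and
    at least [r / M] for [M >= 1], as the weighted averages require. *)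
Definition weight (F : V -> V) (r : R) (x : V) : R :=
  if F x == 0 then r else r / N (F x).

Lemma descent_pointE (F : V -> V) (r : R) (x : V) :
  descent_point dot F r x = x - weight F r x *: F x.
Proof.
by rewrite /descent_point /weight; case: eqP => // ->; rewrite scaler0 subr0.
Qed.

Lemma dnorm_gt0 (u : V) : (0 < N u) = (u != 0).
Proof.
rewrite lt_def dnorm_ge0 andbT; congr (~~ _).
by apply/eqP/eqP => [/dnorm_eq0->|->] //; rewrite dnorm0.
Qed.

Lemma weight_gt0 (F : V -> V) (r : R) (x : V) : 0 < r -> 0 < weight F r x.
Proof.
by rewrite /weight; case: eqVneq => // Fx r0; rewrite divr_gt0 ?dnorm_gt0.
Qed.

Lemma weight_norm (F : V -> V) (r : R) (x : V) :
  F x != 0 -> weight F r x * N (F x) = r.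
Proof. by move=> Fx; rewrite /weight (negbTE Fx) divfK ?gt_eqF ?dnorm_gt0. Qed.

Lemma weight_norm_le (F : V -> V) (r : R) (x : V) :
  0 < r -> weight F r x * N (F x) <= r.
Proof.
move=> /ltW r0; have [Fx|/weight_norm-> //] := eqVneq (F x) 0.
by rewrite Fx dnorm0 mulr0.
Qed.

Lemma weight_ge (F : V -> V) (r M : R) (x : V) : 0 < r -> 1 <= M ->
  N (F x) <= M -> r / M <= weight F r x.
Proof.
move=> r0 M1 FM; rewrite /weight; case: eqVneq => [_|Fx].
  by rewrite ler_pdivrMr ?(lt_le_trans ltr01)// ler_peMr// ltW.
by rewrite ler_pM2l// lef_pV2 ?posrE ?dnorm_gt0// (lt_le_trans ltr01).
Qed.

End RelaxedProjection.

(** * The fixed point set of a cutter and the distance to it *)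

Section CutterDistance.
Variables (R : realType) (n : nat) (dot : {dot 'rV[R]_n for idfun}).
Local Notation V := 'rV[R]_n.
Local Notation N := (dnorm dot).
Variable T : V -> V.
Hypothesis hT : cutter dot T.
Local Notation C := (Fix T).
Local Notation D u := (dist dot u C).

(* Taking x = w in the condition forces T w = w. *)
Lemma FixP (w : V) : C w <-> forall x, dot (T x - x) (T x - w) <= 0.
Proof.
split=> [Cw x|/(_ w) le0]; first by apply: (proj2 hT); exact: mem_set.
apply/eqP; rewrite -subr_eq0; apply/eqP/(@dnorm_eq0 _ _ dot)/eqP.
by rewrite -sqrf_eq0 eq_le sqr_ge0 dnorm_sqr le0.
Qed.

Lemma Fix_halfspace (x w : V) : C w -> halfspace dot x (T x) w.
Proof.
move=> /FixP/(_ x); rewrite /halfspace /=.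
by rewrite -(opprB x) -(opprB w) dotNl dotNr opprK dotC.
Qed.

(** By [FixP] the fixed point set is an intersection of closed half-spaces; the same description
    gives [Fix_convex]. *)
Lemma Fix_closed (l : V) :
  (forall e, 0 < e -> exists2 y, C y & N (y - l) < e) -> C l.
Proof.
move=> h; apply/FixP => x; apply/ler_addgt0Pl => e e0; rewrite addr0.
set g := T x - x.
(* Dividing by [N g + 1] instead of [N g] covers the case [g = 0]; the same device recurs below. *)
have g1 : 0 < N g + 1 by rewrite ltr_wpDl ?dnorm_ge0.
have [y /FixP/(_ x) Cy yl] := h _ (divr_gt0 e0 g1).
have -> : T x - l = (T x - y) + (y - l) by rewrite addrA subrK.
rewrite dotDr ler_wnDl//; apply: le_trans (cauchy_schwarz _ _ _) _.
move: yl; rewrite ltr_pdivlMr// => yl.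
have := dnorm_ge0 dot (y - l); lra.
Qed.

Lemma dist_le (x u : V) : C u -> D x <= N (x - u).
Proof.
move=> Cu; apply: ge_inf; last by exists u.
by exists 0 => _ [z _ <-]; exact: dnorm_ge0.
Qed.

Lemma dist_lt_near (x : V) (e : R) : 0 < e -> exists2 u, C u & N (x - u) < D x + e.
Proof.
move=> e0.
have [|_ [u Cu <-] ue] := @inf_adherent _ [set N (x - z) | z in C] e e0.
  split; last by exists 0 => _ [z _ <-]; exact: dnorm_ge0.
  by have [z Cz] := proj1 hT; exists (N (x - z)), z.
by exists u.
Qed.

Lemma dist_ge0 (x : V) : 0 <= D x.
Proof.
apply: lb_le_inf; last by move=> _ [z _ <-]; exact: dnorm_ge0.
by have [z Cz] := proj1 hT; exists (N (x - z)), z.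
Qed.

(** Near-minimizers are bounded, so they cluster, and closedness puts the cluster point in [C]. *)
Lemma dist_attained (x : V) : exists2 p, C p & N (x - p) = D x.
Proof.
have /choice[y yP] (m : nat) : exists u, C u /\ N (x - u) < D x + m.+1%:R^-1.
  have [|u Cu ux] := @dist_lt_near x m.+1%:R^-1; first by rewrite invr_gt0.
  by exists u.
have m1 m : m.+1%:R^-1 <= 1 :> R by rewrite invf_le1// ler1n.
have [k|l cl] := @dnorm_cluster _ _ dot y (N x + D x + 1).
  have [_ yx] := yP k; have := dnormD dot x (- (x - y k)).
  rewrite dnormN opprB addrCA subrr addr0.
  by move: (m1 k) yx; move: (k.+1%:R^-1) => e; lra.
have Cl : C l.
  apply: Fix_closed => e e0; have [k _ ke] := cl _ e0 0%N.
  by exists (y k) => //; have [] := yP k.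
exists l => //; apply/eqP; rewrite eq_le dist_le// andbT.
apply/ler_addgt0Pl => e e0.
have e2 : 0 < e / 2 by rewrite divr_gt0.
have [k mk ke] := cl _ e2 (Num.bound (e / 2)^-1).
have [_ yx] := yP k.
have kb : k.+1%:R^-1 <= e / 2.
  rewrite -[leRHS]invrK lef_pV2 ?posrE ?invr_gt0// ltW//.
  apply: lt_le_trans (archi_boundP _) _; first by rewrite invr_ge0 ltW.
  by rewrite ler_nat leqW.
by move: kb yx; move: (k.+1%:R^-1) => e'; have := dnorm_triangle dot (y k) x l; lra.
Qed.

Lemma dist_lipschitz (x y : V) : D x <= D y + N (x - y).
Proof.
have [p Cp <-] := dist_attained y; rewrite addrC.
exact: le_trans (dist_le _ Cp) (dnorm_triangle _ _ _ _).
Qed.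

Lemma Fix_enlargement (r : R) (w : V) : 0 <= r -> C w -> enlargement dot C r w.
Proof.
move=> r0 Cw; rewrite /enlargement /=.
by rewrite (le_trans (dist_le w Cw))// subrr dnorm0.
Qed.

Lemma Fix_convex (u v : V) (t : R) : 0 <= t <= 1 -> C u -> C v ->
  C (u + t *: (v - u)).
Proof.
move=> /andP[t0 t1] /FixP Cu /FixP Cv; apply/FixP => x.
have := Cu x; have := Cv x; rewrite !dotE; nra.
Qed.

(* A point where the residual vanishes in the limit is fixed, so compactness
   bounds the residual below away from the fixed point set. *)
Lemma residual_gap (M d : R) : residual_closed_at0 dot T -> 0 < d ->
  exists2 eta, 0 < eta &
    forall u, N u <= M -> d <= D u -> eta <= N (T u - u).
Proof.
move=> hcl d0; apply: contrapT => /forall2NP gap.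
have /choice[y yP] (m : nat) : exists u,
    [/\ N u <= M, d <= D u & N (T u - u) < m.+1%:R^-1].
  have [/negP|/existsNP[u]] := gap m.+1%:R^-1; first by rewrite invr_gt0 ltr0Sn.
  move=> /not_implyP[Mu /not_implyP[du /negP]]; rewrite -ltNge => ?.
  by exists u.
have [k|l cl] := @dnorm_cluster _ _ dot y M; first by have [] := yP k.
have /choice[s sP] (m : nat) : exists k, (m <= k)%N /\ N (y k - l) < m.+1%:R^-1.
  have [|k mk kl] := cl m.+1%:R^-1 _ m; first by rewrite invr_gt0.
  by exists k.
have inv_small (e : R) : 0 < e -> exists m, forall k, (m <= k)%N ->
    k.+1%:R^-1 < e.
  move=> e0; exists (Num.bound e^-1) => k mk.
  rewrite -[ltRHS]invrK ltf_pV2 ?posrE ?invr_gt0//.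
  apply: lt_le_trans (archi_boundP _) _; first by rewrite invr_ge0 ltW.
  by rewrite ler_nat leqW.
have : l \in C.
  apply: (hcl (y \o s)).
    apply: (@cvg_dnorm _ _ dot) => e /inv_small[m hm].
    by exists m => k /hm; apply: lt_trans; have [] := sP k.
  apply/cvgrPdist_lt => e /inv_small[m hm].
  exists m => // k /= mk; rewrite sub0r normrN ger0_norm ?dnorm_ge0//.
  have [_ _ /lt_trans] := yP (s k); apply; apply: hm.
  by rewrite (leq_trans mk)//; have [] := sP k.
move=> /set_mem Cl; have [k _ kl] := cl _ d0 0%N.
have [_ + _] := yP k; apply/negP; rewrite -ltNge.
exact: le_lt_trans (dist_le _ Cl) kl.
Qed.

(** If [F] were unbounded there, points with [F] growing would cluster at some [l]; the enlargement
    is closed because the distance is Lipschitz, and continuity at [l] bounds [F] nearby by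
    [N (F l) + 1]. *)
Lemma continuous_bounded (F : V -> V) (eps M : R) :
  {within enlargement dot C eps, continuous F} ->
  exists2 B, 1 <= B & forall u, N u <= M -> D u <= eps -> N (F u) <= B.
Proof.
move=> cF; apply: contrapT => /forall2NP unb.
have /choice[y yP] (m : nat) : exists u,
    [/\ N u <= M, D u <= eps & m.+1%:R < N (F u)].
  have [/negP|/existsNP[u]] := unb m.+1%:R; first by rewrite ler1n.
  move=> /not_implyP[Mu /not_implyP[du /negP]]; rewrite -ltNge => ?.
  by exists u.
have [k|l cl] := @dnorm_cluster _ _ dot y M; first by have [] := yP k.
have Al : enlargement dot C eps l.
  rewrite /enlargement /=; apply/ler_addgt0Pr => e e0.
  have [k _ kl] := cl _ e0 0%N; have [_ yk _] := yP k.
  by have := dist_lipschitz l (y k); rewrite dnormBC; lra.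
have [d d0 hd] := within_continuous_dnorm dot cF Al ltr01.
have [k mk kl] := cl _ d0 (Num.bound (N (F l) + 1)).
have [_ Ak big] := yP k.
have := hd _ Ak kl; have := dnormD dot (F (y k) - F l) (F l); rewrite subrK.
have : N (F l) + 1 < k.+1%:R.
  apply: lt_le_trans (archi_boundP _) _; first by rewrite addr_ge0 ?dnorm_ge0.
  by rewrite ler_nat leqW.
lra.
Qed.

End CutterDistance.

(** * Divergent series and the descent argument they drive *)

Section DivergentSums.
Variable R : realType.

Definition divergent_sum (w : nat -> R) : Prop :=
  forall A : R, exists m, forall k, (m <= k)%N -> A < \sum_(0 <= i < k) w i.

Lemma divergent_sum_eseries (w : nat -> R) : (forall k, 0 <= w k) ->
  (\sum_(1 <= k <oo) (w k)%:E = +oo)%E -> divergent_sum w.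
Proof.
move=> w0 woo A; apply: contrapT => /forallNP unb.
(* The terms are nonnegative, so a bound that holds at arbitrarily late indices holds for all
   partial sums. *)
have sum_le k : \sum_(1 <= i < k) w i <= A.
  have /existsNP[j /not_implyP[kj /negP]] := unb k.
  rewrite -leNgt; apply: le_trans.
  have [k1|k1] := leqP k 1; first by rewrite big_geq ?sumr_ge0.
  rewrite [leRHS](@big_cat_nat _ _ _ 1)//=; last exact: leq_trans (ltnW k1) kj.
  rewrite [X in _ <= _ + X](@big_cat_nat _ _ _ k)//=; last exact: ltnW.
  have h p q : 0 <= \sum_(p <= i < q) w i by rewrite sumr_ge0.
  by have := h 0%N 1%N; have := h k j; lra.
suff : (+oo <= A%:E :> \bar R)%E by rewrite leye_eq.
rewrite -woo; apply: lime_le.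
  by apply: is_cvg_ereal_nneg_natsum => k _; rewrite lee_fin.
by apply: nearW => k; rewrite sumEFin lee_fin.
Qed.

(* Being above [a] forces a decrease proportional to [rho], which cannot go on
   forever, and [b] bounds the next value after a visit below [a]. *)
Lemma descent_eventually_le (rho u : nat -> R) (a b c : R) (m : nat) :
  divergent_sum rho -> (forall k, 0 <= rho k) -> (forall k, 0 <= u k) ->
  0 < c -> a <= b ->
  (forall k, (m <= k)%N -> a <= u k -> u k.+1 <= u k - c * rho k) ->
  (forall k, (m <= k)%N -> u k < a -> u k.+1 <= b) ->
  exists m', forall k, (m' <= k)%N -> u k <= b.
Proof.
move=> rhoo rho0 u0 c0 ab dec low.
have [k0 mk0 uk0] : exists2 k, (m <= k)%N & u k <= b.
  apply: contrapT => /forall2NP nob.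
  have ub k : (m <= k)%N -> b < u k.
    by move=> mk; have [//|/negP] := nob k; rewrite -ltNge.
  pose s k := \sum_(0 <= i < k) rho i.
  have us k : (m <= k)%N -> u k + c * s k <= u m + c * s m.
    elim: k => [|k IH]; first by rewrite leqn0 => /eqP ->.
    rewrite leq_eqVlt => /orP[/eqP -> //|]; rewrite ltnS => mk.
    have := IH mk; have := dec _ mk (le_trans ab (ltW (ub _ mk))).
    by rewrite /s big_nat_recr//=; lra.
  have [j jP] := rhoo ((u m + c * s m) / c).
  have := jP (maxn j m) (leq_maxl _ _); rewrite ltr_pdivrMr// -/(s _).
  have := us _ (leq_maxr j m); have := u0 (maxn j m); lra.
exists k0; elim=> [|k IH]; first by rewrite leqn0 => /eqP <-.
rewrite leq_eqVlt => /orP[/eqP <- //|]; rewrite ltnS => k0k.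
have mk := leq_trans mk0 k0k; have ukb := IH k0k.
have [auk|/low] := leP a (u k); last exact.
have := dec _ mk auk; have := mulr_ge0 (ltW c0) (rho0 k); lra.
Qed.

End DivergentSums.

(** * Weighted averages of the iterates *)

Section ErgodicAverages.
Variables (R : realType) (n : nat) (dot : {dot 'rV[R]_n for idfun}).
Local Notation V := 'rV[R]_n.
Local Notation N := (dnorm dot).
Variables (w : nat -> R) (x : nat -> V).
Hypotheses (w0 : forall k, 0 < w k) (woo : divergent_sum w).

(** The weighted averages of [a] have upper limit at most 0, with the total weight multiplied out;
    [B] absorbs initial terms and is negligible once the weights diverge. *)
Definition ergodic_le0 (a : nat -> R) : Prop :=
  forall e : R, 0 < e -> exists (B : R) (m : nat), forall k, (m <= k)%N ->
    \sum_(0 <= i < k) w i * a i <= B + e * \sum_(0 <= i < k) w i.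

Lemma telescope_ergodic_le0 (a : nat -> R) :
  (forall e : R, 0 < e -> exists (v : nat -> R) (m : nat),
    (forall k, 0 <= v k) /\
    forall k, (m <= k)%N -> w k * a k <= v k - v k.+1 + e * w k) ->
  ergodic_le0 a.
Proof.
move=> h e /h[v [m [v0 vP]]].
exists (\sum_(0 <= i < m) w i * a i - e * \sum_(0 <= i < m) w i + v m), m.
move=> k mk; rewrite -lerBlDr.
suff : \sum_(0 <= i < k) w i * a i - e * \sum_(0 <= i < k) w i + v k <=
  \sum_(0 <= i < m) w i * a i - e * \sum_(0 <= i < m) w i + v m.
  by have := v0 k; lra.
elim: k mk => [|k IH]; first by rewrite leqn0 => /eqP ->.
rewrite leq_eqVlt => /orP[/eqP -> //|]; rewrite ltnS => mk.
have := IH mk; have := vP _ mk.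
by rewrite !big_nat_recr//=; lra.
Qed.

Lemma eventually_ergodic_le0 (a : nat -> R) :
  (forall e : R, 0 < e -> exists m, forall k, (m <= k)%N -> a k <= e) ->
  ergodic_le0 a.
Proof.
move=> h; apply: telescope_ergodic_le0 => e /h[m mP].
exists (fun=> 0), m; split=> // k mk; rewrite subrr add0r mulrC.
by rewrite ler_pM2r// mP.
Qed.

(** Affine functionals commute with averaging, so they pass to a cluster point of the averages. The
    point [l] is chosen before [g] and [c], so it serves all functionals at once. *)
Lemma ergodic_cluster (M : R) : (forall k, N (x k) <= M) ->
  exists l : V, forall (g : V) (c : R),
    ergodic_le0 (fun k => dot g (x k) + c) -> dot g l + c <= 0.
Proof.
move=> xM; pose s k := \sum_(0 <= i < k) w i.
pose t k := \sum_(0 <= i < k) w i *: x i.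
have s0 k : 0 < s k.+1.
  by rewrite /s big_nat_recr//= ltr_wpDl// sumr_ge0// => i _; exact: ltW.
have tM k : N (t k) <= s k * M.
  elim: k => [|k IH]; first by rewrite /t /s !big_nil dnorm0 mul0r.
  rewrite /t /s !big_nat_recr//= -/(t k) -/(s k) (le_trans (dnormD _ _ _))//.
  rewrite mulrDl lerD// dnormZ gtr0_norm//.
  by rewrite ler_pM2l.
(* The shift to [k.+1] avoids the empty sum, whose total weight is 0. *)
have [k|l cl] := @dnorm_cluster _ _ dot (fun k => (s k.+1)^-1 *: t k.+1) M.
  by rewrite dnormZ gtr0_norm ?invr_gt0// mulrC ler_pdivrMr// mulrC.
exists l => g c erg; apply/ler_addgt0Pl => e e0; rewrite addr0.
(* One third each for the error of the average against [l], for the slack in [erg], and for the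
   constant [B]. *)
have e3 : 0 < e / 3 by rewrite divr_gt0.
have [B [m Bm]] := erg _ e3.
have [m' m'P] := woo (B / (e / 3)).
have g1 : 0 < N g + 1 by rewrite ltr_wpDl ?dnorm_ge0.
have [k mk kl] := cl _ (divr_gt0 e3 g1) (maxn m m').
have [mk1 mk2] : (m <= k.+1)%N /\ (m' <= k.+1)%N.
  by move: mk; rewrite geq_max => /andP[? ?]; rewrite !leqW.
set y := _ *: t _ in kl.
have -> : dot g l + c = (dot g y + c) + dot g (l - y) by rewrite dotDr dotNr; ring.
have h1 : dot g (l - y) <= e / 3.
  apply: le_trans (cauchy_schwarz _ _ _) _.
  move: kl; rewrite ltr_pdivlMr// dnormBC.
  by have := dnorm_ge0 dot (l - y); lra.
have h2 : \sum_(0 <= i < k.+1) w i * (dot g (x i) + c) = s k.+1 * (dot g y + c).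
  rewrite mulrDr /y dotZr mulrA mulfV ?gt_eqF// mul1r.
  rewrite /t /s mulr_suml; elim: (k.+1) => [|j IH].
    by rewrite !big_nil dot0r addr0.
  by rewrite !big_nat_recr//= IH dotDr dotZr; ring.
have := Bm _ mk1; rewrite h2 -/(s _).
have := m'P _ mk2; rewrite -/(s _) ltr_pdivrMr// => h3 h4.
have : s k.+1 * (dot g y + c) <= s k.+1 * (2 * (e / 3)) by lra.
by rewrite ler_pM2l//; lra.
Qed.

End ErgodicAverages.

(** * One-step estimates and boundedness of the iterates *)

Section Iteration.
Variables (R : realType) (n : nat) (dot : {dot 'rV[R]_n for idfun}).
Local Notation V := 'rV[R]_n.
Local Notation N := (dnorm dot).
Variables (T F : V -> V) (rho al : nat -> R) (mu : R) (x : nat -> V).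
Local Notation C := (Fix T).
Local Notation D u := (dist dot u C).
Hypotheses (hT : cutter dot T) (hclosed : residual_closed_at0 dot T).
Hypotheses (rho0 : forall k, 0 < rho k) (rhoo : divergent_sum rho).
Hypothesis rho_small : forall e : R, 0 < e -> exists m, forall k, (m <= k)%N -> rho k <= e.
Hypotheses (hmu : 0 < mu) (hal : forall k, mu <= al k <= 2 - mu).
Hypothesis hx : generated dot T F rho al x.
Local Notation wt k := (weight dot F (rho k) (x k)).
Local Notation z k := (descent_point dot F (rho k) (x k)).

Lemma step_proj (k : nat) (w : V) : C w ->
  N (x k.+1 - w) ^+ 2 <= N (z k - w) ^+ 2
    - mu ^+ 2 * N (metric_proj dot (halfspace dot (x k) (T (x k))) (z k) - z k) ^+ 2.
Proof.
move=> Cw; rewrite hx; apply: relaxed_proj_le => //.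
exact: Fix_halfspace.
Qed.

Lemma step_gradient (k : nat) (w : V) : C w ->
  N (x k.+1 - w) ^+ 2 <=
    N (x k - w) ^+ 2 - 2 * (wt k * dot (F (x k)) (x k - w)) + rho k ^+ 2.
Proof.
move=> Cw; have := step_proj k Cw.
set P := N (metric_proj _ _ _ - _).
have : 0 <= mu ^+ 2 * P ^+ 2 by rewrite mulr_ge0// sqr_ge0.
rewrite descent_pointE addrAC (dnormB_sqr dot (x k - w)) dnormZ dotZr.
rewrite gtr0_norm ?weight_gt0// dotC.
have w0 : 0 <= wt k by rewrite ltW// weight_gt0.
have : (wt k * N (F (x k))) ^+ 2 <= rho k ^+ 2.
  rewrite ler_pXn2r ?weight_norm_le// nnegrE ?(ltW (rho0 k))//.
  by rewrite mulr_ge0 ?dnorm_ge0.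
lra.
Qed.

Lemma dist_descent_point (k : nat) : N (z k - x k) <= rho k.
Proof.
rewrite descent_pointE addrAC subrr add0r dnormN dnormZ.
by rewrite gtr0_norm ?weight_gt0// weight_norm_le.
Qed.

Lemma step_le (k : nat) (w : V) : C w -> N (x k.+1 - w) <= N (x k - w) + rho k.
Proof.
move=> Cw; apply: (@le_trans _ _ (N (z k - w))).
  rewrite dnorm_le_sqr; have := step_proj k Cw.
  set P := N (metric_proj _ _ _ - _).
  have : 0 <= mu ^+ 2 * P ^+ 2 by rewrite mulr_ge0// sqr_ge0.
  lra.
have := dnorm_triangle dot (x k) (z k) w; have := dist_descent_point k; lra.
Qed.

(** The half-space is at least [eta] away from [x k], while [z k] is within [rho k] of [x k]; hence
    the projection moves [z k] by at least [eta - rho k]. *)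
Lemma step_residual (k : nat) (w : V) (eta : R) : C w ->
  rho k <= eta -> eta <= N (T (x k) - x k) ->
  N (x k.+1 - w) ^+ 2 <= (N (x k - w) + rho k) ^+ 2 - mu ^+ 2 * (eta - rho k) ^+ 2.
Proof.
move=> Cw rho_eta eta_res; have := step_proj k Cw.
have /= [Hp _] := halfspace_proj dot (x k) (T (x k)) (z k).
set p := metric_proj _ _ _ in Hp *.
have := dist_halfspace Hp; have := dnorm_triangle dot (z k) p (x k).
have := dnorm_triangle dot (x k) (z k) w; have := dist_descent_point k.
move=> h1 h2 h3 h4 h5.
have h6 : (eta - rho k) ^+ 2 <= N (p - z k) ^+ 2.
  rewrite ler_pXn2r ?nnegrE ?dnorm_ge0 ?subr_ge0//; lra.
have h7 : N (z k - w) ^+ 2 <= (N (x k - w) + rho k) ^+ 2.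
  by rewrite ler_pXn2r ?nnegrE ?dnorm_ge0 ?addr_ge0 ?dnorm_ge0 ?(ltW (rho0 k))//; lra.
have := ler_wpM2l (sqr_ge0 mu) h6; lra.
Qed.

(** Once [rho k <= 2 * beta], coercivity outside [E] makes the gradient gain [2 * beta * rho k]
    cover the error [rho k ^+ 2], so the distance to [q] does not grow; a step starting in [E] adds
    at most [2 * beta]. *)
Lemma iterates_bounded (q : V) (beta : R) (E : set V) : C q -> 0 < beta ->
  bounded_set E ->
  (forall u, u \notin E -> beta * N (F u) <= dot (F u) (u - q)) ->
  exists M, forall k, N (x k) <= M.
Proof.
move=> Cq beta0 /(bounded_set_dnorm dot)[ME ME0 EM] coer.
have [m mP] := rho_small (mulr_gt0 (ltr0Sn R 1) beta0).
pose B := Num.max (N (x m - q)) (ME + N q + 2 * beta).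
have bB k : (m <= k)%N -> N (x k - q) <= B.
  elim: k => [|k IH]; first by rewrite leqn0 /B => /eqP ->; rewrite le_max lexx.
  rewrite leq_eqVlt => /orP[/eqP <-|]; first by rewrite /B le_max lexx.
  rewrite ltnS => mk; have [Exk|nExk] := boolP (x k \in E).
    rewrite /B le_max; apply/orP; right.
    have := step_le k Cq; have := mP _ mk; have := EM _ (set_mem Exk).
    have := dnormD dot (x k) (- q); rewrite dnormN; lra.
  apply: le_trans (IH mk); rewrite dnorm_le_sqr.
  have := step_gradient k Cq; have := coer _ nExk; have := mP _ mk.
  have r0 := rho0 k.
  have w0 : 0 < wt k by exact: weight_gt0.
  have [Fx|Fx] := eqVneq (F (x k)) 0.
    (* Here [step_gradient] would leave an uncompensated [rho k ^+ 2], but [z k = x k], so the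
       projection estimate alone suffices. *)
    move=> _ _ _; have := step_proj k Cq; rewrite /descent_point Fx eqxx.
    set P := N (metric_proj _ _ _ - _).
    have : 0 <= mu ^+ 2 * P ^+ 2 by rewrite mulr_ge0// sqr_ge0.
    lra.
  move=> h1 /(ler_wpM2l (ltW w0)); rewrite mulrCA weight_norm// => h2.
  have : rho k ^+ 2 <= rho k * (2 * beta) by rewrite expr2 ler_wpM2l// ltW.
  lra.
exists (N q + B + \sum_(i < m) N (x i - q)) => k.
have xk : N (x k) <= N q + N (x k - q).
  by have := dnormD dot (x k - q) q; rewrite subrK; lra.
have s0 : 0 <= \sum_(i < m) N (x i - q).
  by rewrite sumr_ge0// => i _; exact: dnorm_ge0.
have [/bB|km] := leqP m k; first by lra.
have B0 : 0 <= B by rewrite le_max dnorm_ge0.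
rewrite (bigD1 (Ordinal km))//=; rewrite (bigD1 (Ordinal km))//= in s0.
have : 0 <= \sum_(i < m | i != Ordinal km) N (x i - q).
  by rewrite sumr_ge0// => i _; exact: dnorm_ge0.
lra.
Qed.

(** * Bounded iterates approach the fixed point set *)

Variable M : R.
Hypothesis xM : forall k, N (x k) <= M.

Lemma dist_iterates_small (e : R) : 0 < e ->
  exists m, forall k, (m <= k)%N -> D (x k) <= e.
Proof.
move=> e0.
have e2 : 0 < e / 2 by rewrite divr_gt0.
have [eta eta0 gap] := residual_gap M hclosed e2.
have [q Cq] := proj1 hT.
have M0 : 0 <= M := le_trans (dnorm_ge0 _ _) (xM 0%N).
pose MD := M + N q.
have MD0 : 0 <= MD by rewrite addr_ge0// dnorm_ge0.
have DM k : D (x k) <= MD.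
  have := dist_le dot (x k) Cq; have := dnormD dot (x k) (- q).
  by rewrite dnormN; have := xM k; rewrite /MD; lra.
(* For [rho k <= eta / 2] the projection gains at least [mu ^+ 2 * eta ^+ 2 / 4]. In [2 * MD + 2],
   [2 * MD] pays for the cross term, one unit for [rho k ^+ 2 <= rho k], and one is the decrease
   [1 * rho k] that remains. *)
have me0 : 0 < mu ^+ 2 * eta ^+ 2 / 4 by rewrite divr_gt0// mulr_gt0// exprn_gt0.
have K0 : 0 < 2 * MD + 2 by lra.
have [m1 m1P] := rho_small ltr01.
have [m2 m2P] := rho_small (divr_gt0 eta0 (ltr0Sn R 1)).
have [m3 m3P] := rho_small (divr_gt0 me0 K0).
have [m4 m4P] := rho_small e2.
pose m := maxn (maxn m1 m2) (maxn m3 m4).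
have mm k : (m <= k)%N -> [/\ (m1 <= k)%N, (m2 <= k)%N, (m3 <= k)%N & (m4 <= k)%N].
  by rewrite /m !geq_max => /andP[/andP[-> ->] /andP[-> ->]].
have D0 k : 0 <= D (x k) by exact: dist_ge0.
have [||||||m' m'P] := @descent_eventually_le R rho (fun k => D (x k) ^+ 2)
    ((e / 2) ^+ 2) (e ^+ 2) 1 m rhoo.
- by move=> k; exact/ltW.
- by move=> k; exact: sqr_ge0.
- exact: ltr01.
- by rewrite ler_pXn2r ?nnegrE ?(ltW e0) ?(ltW e2)//; lra.
- move=> k /mm[/m1P r1 /m2P r2 /m3P r3 _].
  rewrite ler_pXn2r ?nnegrE ?D0 ?(ltW e2)// => Dk.
  have [p Cp pk] := dist_attained hT (x k).
  have := step_residual Cp _ (gap _ (xM k) Dk); rewrite pk.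
  have /[swap] /[apply] : rho k <= eta by lra.
  have : D (x k.+1) ^+ 2 <= N (x k.+1 - p) ^+ 2.
    by rewrite ler_pXn2r ?nnegrE ?D0 ?dnorm_ge0// dist_le.
  have : mu ^+ 2 * (eta / 2) ^+ 2 <= mu ^+ 2 * (eta - rho k) ^+ 2.
    rewrite ler_wpM2l ?sqr_ge0// ler_pXn2r ?nnegrE//; lra.
  move: r3; rewrite ler_pdivlMr//.
  have := ler_wpM2l (ltW (rho0 k)) (DM k).
  have : rho k ^+ 2 <= rho k by rewrite expr2 ler_piMr// ltW.
  lra.
- move=> k /mm[_ _ _ /m4P r4]; rewrite ltr_pXn2r ?nnegrE ?D0 ?(ltW e2)// => Dk.
  rewrite ler_pXn2r ?nnegrE ?D0 ?(ltW e0)//.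
  have [p Cp pk] := dist_attained hT (x k).
  by have := dist_le dot (x k.+1) Cp; have := step_le k Cp; rewrite pk; lra.
exists m' => k /m'P; rewrite ler_pXn2r ?nnegrE ?D0 ?(ltW e0)//.
Qed.

(** * Existence and uniqueness of the solution, and convergence to it *)

Variables (eps1 eps2 a : R).
Hypotheses (eps10 : 0 < eps1) (hcont : {within enlargement dot C eps1, continuous F}).
Hypotheses (eps20 : 0 < eps2) (a0 : 0 < a).
Hypothesis hmono : strongly_monotone dot a (enlargement dot C eps2) F.

Lemma eventually_regular : exists (B : R) (m : nat), 1 <= B /\
  forall k, (m <= k)%N -> rho k / B <= wt k /\ enlargement dot C eps2 (x k).
Proof.
have [B B1 FB] := continuous_bounded hT M hcont.
have [m1 m1P] := dist_iterates_small eps10.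
have [m2 m2P] := dist_iterates_small eps20.
exists B, (maxn m1 m2); split=> // k; rewrite geq_max => /andP[/m1P k1 /m2P k2].
by split=> //; apply: weight_ge => //; exact: FB.
Qed.

(** [F] is bounded near the fixed point set, so eventually [wt k] dominates a fixed multiple of
    [rho k]. *)
Lemma divergent_weight : divergent_sum (fun k => wt k).
Proof.
have [B [m [B1 mP]]] := eventually_regular => A.
have B0 : 0 < B by rewrite (lt_le_trans ltr01).
have [m' m'P] := rhoo (B * A + \sum_(0 <= i < m) rho i).
exists (maxn m m') => k; rewrite geq_max => /andP[mk /m'P].
suff : (\sum_(0 <= i < k) rho i - \sum_(0 <= i < m) rho i) / B <=
    \sum_(0 <= i < k) wt i.
  by rewrite ler_pdivrMr// => h1 h2; rewrite -(ltr_pM2l B0); lra.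
have s0 : 0 <= \sum_(0 <= i < m) wt i.
  by rewrite sumr_ge0// => i _; rewrite ltW// weight_gt0.
rewrite !(@big_cat_nat _ _ _ m 0%N k)//= addrAC subrr add0r.
rewrite ler_wpDl// mulr_suml ler_sum_nat// => i /andP[mi _].
by have [] := mP _ mi.
Qed.

(** Both claims are affine inequalities in [l], so it suffices to have them on average along the
    iterates. Membership in [C] uses that the distances vanish; for Minty, monotonicity replaces
    [F (x k)] by the fixed [F w] and [step_gradient] telescopes. *)
Lemma minty_point : exists2 l, C l &
  forall w, C w -> dot (F w) (l - w) <= 0.
Proof.
have w0 k : 0 < wt k by exact: weight_gt0.
have [l lP] := ergodic_cluster w0 divergent_weight xM.
exists l => [|w Cw].
  apply/(FixP hT) => y; set g := T y - y.
  have -> : dot g (T y - l) = dot (- g) l + dot g (T y).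
    by rewrite dotDr dotNr dotNl addrC.
  apply: lP; apply: eventually_ergodic_le0 => // e e0.
  have g1 : 0 < N g + 1 by rewrite ltr_wpDl ?dnorm_ge0.
  have [m mP] := dist_iterates_small (divr_gt0 e0 g1).
  exists m => k /mP; rewrite ler_pdivlMr// => Dk.
  have [p Cp pk] := dist_attained hT (x k).
  have -> : dot (- g) (x k) + dot g (T y) = dot g (T y - p) + dot g (p - x k).
    by rewrite !dotDr !dotNr dotNl; ring.
  have /(FixP hT)/(_ y) h1 := Cp.
  have := cauchy_schwarz dot g (p - x k); rewrite dnormBC pk.
  have := dist_ge0 hT (x k); rewrite -/g in h1; lra.
rewrite dotDr dotNr; apply: lP; apply: telescope_ergodic_le0 => // e e0.
have [B [m [B1 mP]]] := eventually_regular.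
have B0 : 0 < B by rewrite (lt_le_trans ltr01).
have [m' m'P] := rho_small (divr_gt0 e0 B0).
exists (fun k => N (x k - w) ^+ 2 / 2), (maxn m m'); split=> [k|k].
  by rewrite divr_ge0// sqr_ge0.
rewrite geq_max => /andP[/mP[wk Ak] /m'P rk].
have := step_gradient k Cw.
have h1 : rho k ^+ 2 <= e * wt k.
  apply: le_trans (ler_wpM2l (ltW e0) wk).
  by rewrite expr2 mulrCA ler_wpM2l// ltW.
have Aw : enlargement dot C eps2 w by apply: Fix_enlargement => //; exact: ltW.
have := hmono (mem_set Ak) (mem_set Aw); rewrite dotDl dotNl => h2.
have h3 : dot (F w) (x k - w) <= dot (F (x k)) (x k - w).
  have : 0 <= a * N (x k - w) ^+ 2 by rewrite mulr_ge0 ?sqr_ge0// ltW.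
  lra.
have := ler_wpM2l (ltW (w0 k)) h3; rewrite [dot (F w) (_ - _)]dotDr dotNr.
have : 0 <= e * wt k by rewrite mulr_ge0// ltW.
lra.
Qed.

(** Minty's argument: test at [y = l + t *: (w - l)], divide by [t], and use continuity of [F] at
    [l] along the segment. *)
Lemma vip_solution_exists : exists l, vip_solution dot F C l.
Proof.
have [l Cl minty] := minty_point.
exists l; split; first exact: mem_set.
move=> w /set_mem Cw; apply/ler_addgt0Pl => e e0.
set v := w - l; have v1 : 0 < N v + 1 by rewrite ltr_wpDl ?dnorm_ge0.
have Al : enlargement dot C eps1 l by apply: Fix_enlargement => //; exact: ltW.
have [d d0 hd] := within_continuous_dnorm dot hcont Al (divr_gt0 e0 v1).
(* The bound 1 keeps [y] in [C] by convexity; the other bound keeps it within [d] of [l]. *)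
pose t := Num.min 1 (d / (N v + 1)).
have t0 : 0 < t by rewrite lt_min ltr01 divr_gt0.
have t1 : t <= 1 by rewrite ge_min lexx.
pose y := l + t *: v.
have Cy : C y by apply: (Fix_convex hT) => //; rewrite t1 ltW.
have Ay : enlargement dot C eps1 y by apply: Fix_enlargement => //; exact: ltW.
have yl : y - l = t *: v by rewrite /y addrAC subrr add0r.
have tv : N (y - l) < d.
  rewrite yl dnormZ gtr0_norm//.
  have : t <= d / (N v + 1) by rewrite ge_min lexx orbT.
  by rewrite ler_pdivlMr//; lra.
have := hd _ Ay tv; rewrite ltr_pdivlMr// => h1.
have := minty _ Cy; rewrite -opprB yl dotNr dotZr oppr_le0 pmulr_rge0// => h2.
have := cauchy_schwarz dot (F y - F l) v; rewrite dotDl dotNl.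
have := dnorm_ge0 dot (F y - F l); lra.
Qed.

Lemma vip_solution_unique (l l' : V) :
  vip_solution dot F C l -> vip_solution dot F C l' -> l = l'.
Proof.
move=> [Cl lP] [Cl' l'P].
have en (u : V) : u \in C -> u \in enlargement dot C eps2.
  by move=> /set_mem Cu; apply/mem_set/Fix_enlargement => //; exact: ltW.
have := hmono (en _ Cl) (en _ Cl'); have := lP _ Cl'; have := l'P _ Cl.
rewrite -(opprB l) dotNr dotDl dotNl => h1 h2 h3.
apply/eqP; rewrite -subr_eq0; apply/eqP/(@dnorm_eq0 _ _ dot)/eqP.
rewrite -sqrf_eq0 eq_le sqr_ge0 andbT -(ler_pM2l a0) mulr0; lra.
Qed.

Lemma iterates_cvg (l : V) : vip_solution dot F C l -> x k @[k --> \oo] --> l.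
Proof.
move=> [/set_mem Cl lP]; apply: (@cvg_dnorm _ _ dot) => e' e'0.
(* The descent lemma yields a non-strict bound by [e]; halving [e'] makes it strict. *)
pose e := e' / 2; have e0 : 0 < e by rewrite divr_gt0.
have e2 : 0 < e / 2 by rewrite divr_gt0.
have [B [m1 [B1 m1P]]] := eventually_regular.
have B0 : 0 < B by rewrite (lt_le_trans ltr01).
(* Half of the strong monotonicity gain at distance [e / 2]; the other half absorbs
   [dot (F l) (x k - l)], which is eventually at least [- b] because [x k] is close to its nearest
   fixed point. *)
pose b := a * (e / 2) ^+ 2 / 2.
have b0 : 0 < b by rewrite divr_gt0// mulr_gt0// exprn_gt0.
have F1 : 0 < N (F l) + 1 by rewrite ltr_wpDl ?dnorm_ge0.
have [m2 m2P] := dist_iterates_small (divr_gt0 b0 F1).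
(* The gradient term gains at least [2 * rho k * b / B]; [rho k <= b / B] lets half of it cover
   [rho k ^+ 2], leaving the rate [b / B]. *)
have c0 : 0 < b / B by rewrite divr_gt0.
have [m3 m3P] := rho_small c0.
have [m4 m4P] := rho_small e2.
pose m := maxn (maxn m1 m2) (maxn m3 m4).
have mm k : (m <= k)%N -> [/\ (m1 <= k)%N, (m2 <= k)%N, (m3 <= k)%N & (m4 <= k)%N].
  by rewrite /m !geq_max => /andP[/andP[-> ->] /andP[-> ->]].
have [||||||m' m'P] := @descent_eventually_le R rho (fun k => N (x k - l) ^+ 2)
    ((e / 2) ^+ 2) (e ^+ 2) (b / B) m rhoo.
- by move=> k; exact/ltW.
- by move=> k; exact: sqr_ge0.
- exact: c0.
- by rewrite ler_pXn2r ?nnegrE ?(ltW e0) ?(ltW e2)//; lra.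
- move=> k /mm[/m1P[wk Ak] /m2P Dk /m3P r3 _] uk.
  have [p Cp pk] := dist_attained hT (x k).
  have Al : enlargement dot C eps2 l by apply: Fix_enlargement => //; exact: ltW.
  have h1 : - b <= dot (F l) (x k - l).
    have -> : x k - l = (p - l) - (p - x k) by exact: subr_shiftl.
    have := lP _ (mem_set Cp); have := cauchy_schwarz dot (F l) (p - x k).
    rewrite dnormBC pk [dot _ (_ - _ - _)]dotDr dotNr.
    move: Dk; rewrite ler_pdivlMr//; have := dist_ge0 hT (x k); lra.
  have := hmono (mem_set Ak) (mem_set Al); rewrite dotDl dotNl => h2.
  have h3 : b <= dot (F (x k)) (x k - l).
    have := ler_wpM2l (ltW a0) uk; rewrite /b in h1 *; lra.
  have h4 : rho k / B * b <= wt k * dot (F (x k)) (x k - l).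
    apply: ler_pM => //; last exact: ltW.
    by rewrite divr_ge0// ltW.
  have := step_gradient k Cl.
  have : rho k ^+ 2 <= rho k * (b / B) by rewrite expr2 ler_wpM2l// ltW.
  by move: h4; rewrite mulrAC -mulrA; lra.
- move=> k /mm[_ _ _ /m4P r4].
  rewrite ltr_pXn2r ?nnegrE ?dnorm_ge0 ?(ltW e2)// => uk.
  rewrite ler_pXn2r ?nnegrE ?dnorm_ge0 ?(ltW e0)//.
  by have := step_le k Cl; lra.
exists m' => k /m'P; rewrite ler_pXn2r ?nnegrE ?dnorm_ge0 ?(ltW e0)//.
by rewrite /e; lra.
Qed.

End Iteration.

(** * Convergence of the algorithm from the stated assumptions *)

Theorem theorem4p5 (R : realType) (n : nat) (dot : {dot 'rV[R]_n for idfun})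
  (T F : 'rV[R]_n -> 'rV[R]_n) (hT : cutter dot T)
  (hcont : exists2 eps : R, 0 < eps &
     {within enlargement dot (Fix T) eps, continuous F})
  (hmono : exists eps a : R, [/\ 0 < eps, 0 < a &
     strongly_monotone dot a (enlargement dot (Fix T) eps) F])
  (hcoer : exists2 q : 'rV[R]_n, q \in Fix T &
     exists (beta : R) (E : set 'rV[R]_n), [/\ 0 < beta, bounded_set E &
       forall x : 'rV[R]_n, x \notin E -> beta * dnorm dot (F x) <= dot (F x) (x - q)])
  (hclosed : residual_closed_at0 dot T)
  (rho : nat -> R) (hrho_pos : forall k, 0 < rho k)
  (hrho_lim : rho k @[k --> \oo] --> (0 : R))
  (hrho_sum : (\sum_(1 <= k <oo) (rho k)%:E = +oo)%E)
  (mu : R) (hmu : 0 < mu < 1)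
  (al : nat -> R) (hal : forall k, mu <= al k <= 2 - mu)
  (x : nat -> 'rV[R]_n) (hx : generated dot T F rho al x) :
  exists xs : 'rV[R]_n,
    unique (vip_solution dot F (Fix T)) xs /\ x k @[k --> \oo] --> xs.
Proof.
have [eps1 eps10 hc] := hcont.
have [eps2 [a [eps20 a0 hm]]] := hmono.
have [q /set_mem Cq [beta [E [beta0 bE coer]]]] := hcoer.
have /andP[mu0 _] := hmu.
have rhoo : divergent_sum rho.
  by apply: divergent_sum_eseries => // k; exact: ltW.
have rho_small (e : R) : 0 < e -> exists m, forall k, (m <= k)%N -> rho k <= e.
  move: hrho_lim => /cvgrPdist_lt h /h[m _ mP].
  exists m => k /mP /=; rewrite sub0r normrN => /ltW; apply: le_trans.
  exact: ler_norm.
have [M xM] := iterates_bounded hT hrho_pos rho_small mu0 hal hx Cq beta0 bE coer.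
have [l hl] := vip_solution_exists hT hclosed hrho_pos rhoo rho_small mu0 hal hx
  xM eps10 hc eps20 a0 hm.
exists l; split; last first.
  exact: (iterates_cvg hT hclosed hrho_pos rhoo rho_small mu0 hal hx
    xM eps10 hc eps20 a0 hm hl).
split=> // l' hl'; exact: (vip_solution_unique eps20 a0 hm hl hl').
Qed.
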